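(* The trace norm $\|\cdot\|_1$ is the minimum element of the class of $L$-norms $\||\cdot\||$ on $\mathbb{M}_n$ satisfying $\omega(A)\le\||A\||$ for all $A\in\mathbb{M}_n$.
   Context: $\mathbb{M}_n$ is the algebra of complex $n\times n$ matrices with identity $I$; $\|A\|_1=\mathrm{Tr}(|A|)$ is the trace norm and $\omega(A)=\sup\{|\langle x,Ax\rangle|:\|x\|=1\}$ the numerical radius. A norm $\||\cdot\||$ on $\mathbb{M}_n$ is an $L$-norm if $\sum_{i=1}^k\||C_iXC_i^*\||\le\||X\||$ for all $k$, all $X$ and all $C_i$ with $\sum_{i=1}^k C_i^*C_i=I$. *)

(* Defs.v *)
From HB Require Import structures.
From mathcomp Require Import all_boot all_order all_algebra.
From mathcomp Require Import complex.
From mathcomp Require Import boolp classical_sets reals.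
Set Implicit Arguments. Unset Strict Implicit. Unset Printing Implicit Defensive.
Import Order.TTheory GRing.Theory Num.Theory.
Local Open Scope ring_scope.

Section Defs.
Variable R : realType.
Local Notation C := (R[i]).

Definition adj m p (A : 'M[C]_(m, p)) : 'M[C]_(p, m) := (map_mx Num.conj A)^T.

Definition inner_form n (A : 'M[C]_n) (x : 'cV[C]_n) : C := (adj x *m A *m x) 0 0.

Definition psd n (P : 'M[C]_n) : Prop :=
  adj P = P /\ forall x : 'cV[C]_n, 0 <= inner_form P x.

(* |A| = (A^* A)^{1/2}, the (unique) positive semidefinite square root of A^* A *)
Definition absmx n (A : 'M[C]_n) : 'M[C]_n :=
  xget 0 [set P | psd P /\ P *m P = adj A *m A].

Definition trnorm n (A : 'M[C]_n) : R := complex.Re (\tr (absmx A)).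

Definition numrad n (A : 'M[C]_n) : R :=
  sup [set r : R | exists x : 'cV[C]_n,
         inner_form 1%:M x = 1 /\ r = Normc.normc (inner_form A x)].

Definition is_norm n (N : 'M[C]_n -> R) : Prop :=
  [/\ forall A, 0 <= N A,
      forall A, N A = 0 -> A = 0,
      forall (c : C) A, N (c *: A) = Normc.normc c * N A
    & forall A B, N (A + B) <= N A + N B].

Definition is_Lnorm n (N : 'M[C]_n -> R) : Prop :=
  is_norm N /\
  forall (k : nat) (Cs : 'I_k -> 'M[C]_n) (X : 'M[C]_n),
    \sum_(i < k) adj (Cs i) *m Cs i = 1%:M ->
    \sum_(i < k) N (Cs i *m X *m adj (Cs i)) <= N X.

End Defs.

(* Main.v *)
(* Write A = V |A| with V unitary. The trace norm is the largest |tr(U A)| over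
   unitaries U, and, writing |A| = Q Q^*, the Frobenius inequality
   2 Re tr(Y^* Z) <= tr(Y^* Y) + tr(Z^* Z) gives
   Re sum_i tr(U_i C_i A C_i^* ) <= ||A||_1 whenever sum_i C_i^* C_i = I; hence the
   trace norm is an L-norm. For minimality, diagonalise V^* = W^* D W with W
   unitary, and let x_i^* be the rows of W. Then
   ||A||_1 = tr(V^* A) = sum_i d_i <x_i, A x_i> with |d_i| = 1, while the
   projections C_i = x_i x_i^* satisfy sum_i C_i^* C_i = I and
   C_i A C_i^* = <x_i, A x_i> C_i, whose numerical radius is at least
   |<x_i, A x_i>|. *)
Require Import Defs.
From HB Require Import structures.
From mathcomp Require Import all_boot all_order all_algebra.
From mathcomp Require Import complex.
From mathcomp Require Import boolp classical_sets reals.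
From mathcomp Require Import ring.
Import Order.TTheory GRing.Theory Num.Theory.
Local Open Scope ring_scope.

Lemma mxtraceB (S : pzRingType) n (A B : 'M[S]_n) : \tr (A - B) = \tr A - \tr B.
Proof. exact: raddfB. Qed.

Section TraceNorm.
Set Implicit Arguments.
Unset Strict Implicit.
Variable R : realType.
Local Notation C := (R[i]).

(** * Adjoints, unitarity and the Frobenius inequality *)

Section Adjoint.
Implicit Types m n p : nat.

(** Passes to the conjugate of the transpose, the form in which the library states unitarity and
    orthogonality. *)
Lemma adjE m n (A : 'M[C]_(m, n)) : adj A = map_mx Num.conj A^T.
Proof. exact: map_trmx. Qed.

Lemma adjK m n (A : 'M[C]_(m, n)) : adj (adj A) = A.
Proof. by apply/matrixP => i j; rewrite !mxE conjCK. Qed.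

Lemma adj_mul m n p (A : 'M[C]_(m, n)) (B : 'M[C]_(n, p)) :
  adj (A *m B) = adj B *m adj A.
Proof. by rewrite /adj map_mxM trmx_mul. Qed.

Lemma adjD m n (A B : 'M[C]_(m, n)) : adj (A + B) = adj A + adj B.
Proof. by rewrite /adj map_mxD linearD. Qed.

Lemma adjB m n (A B : 'M[C]_(m, n)) : adj (A - B) = adj A - adj B.
Proof. by rewrite /adj map_mxB linearB. Qed.

Lemma adjZ m n (c : C) (A : 'M[C]_(m, n)) : adj (c *: A) = c^* *: adj A.
Proof. by rewrite /adj map_mxZ linearZ. Qed.

Lemma adj_id n : adj (1%:M : 'M[C]_n) = 1%:M.
Proof. by rewrite /adj map_mx1 trmx1. Qed.

Lemma adj_diag n (d : 'rV[C]_n) : adj (diag_mx d) = diag_mx (map_mx Num.conj d).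
Proof. by rewrite /adj map_diag_mx tr_diag_mx. Qed.

Lemma unitary_mul_adj m n (U : 'M[C]_(m, n)) :
  U \is unitarymx -> U *m adj U = 1%:M.
Proof. by move/unitarymxP; rewrite adjE. Qed.

Lemma unitary_adj_mul n (U : 'M[C]_n) : U \is unitarymx -> adj U *m U = 1%:M.
Proof. by move/unitary_mul_adj/mulmx1C. Qed.

Lemma mul_adj_unitary m n (U : 'M[C]_(m, n)) :
  U *m adj U = 1%:M -> U \is unitarymx.
Proof. by rewrite adjE => /unitarymxP. Qed.

Lemma adj_unitary n (U : 'M[C]_n) : (adj U \is unitarymx) = (U \is unitarymx).
Proof. by rewrite adjE trmxC_unitary. Qed.

Lemma unitaryZ n (c : C) (U : 'M[C]_n) :
  `|c| = 1 -> U \is unitarymx -> c *: U \is unitarymx.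
Proof.
move=> c1 Uu; apply: mul_adj_unitary.
by rewrite adjZ -scalemxAl -scalemxAr scalerA -normCK c1 expr1n scale1r
  unitary_mul_adj.
Qed.

Lemma mxtrace_adj n (A : 'M[C]_n) : \tr (adj A) = (\tr A)^*.
Proof. by rewrite /adj mxtrace_tr trace_map_mx. Qed.

Lemma mxtrace_adj_mul m n (A : 'M[C]_(m, n)) :
  \tr (adj A *m A) = \sum_i \sum_j `|A j i| ^+ 2.
Proof.
apply: eq_bigr => i _; rewrite mxE; apply: eq_bigr => j _.
by rewrite !mxE normCK mulrC.
Qed.

Lemma mxtrace_adj_mul_ge0 m n (A : 'M[C]_(m, n)) : 0 <= \tr (adj A *m A).
Proof.
by rewrite mxtrace_adj_mul !sumr_ge0 // => i _; rewrite sumr_ge0 // => j _;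
  rewrite exprn_ge0.
Qed.

Lemma mxtrace_adj_mul_eq0 m n (A : 'M[C]_(m, n)) :
  \tr (adj A *m A) = 0 -> A = 0.
Proof.
rewrite mxtrace_adj_mul => /eqP; rewrite psumr_eq0; last first.
  by move=> i _; rewrite sumr_ge0 // => j _; rewrite exprn_ge0.
move=> /allP A0; apply/matrixP => j i; rewrite mxE.
have /implyP/(_ isT) := A0 i (mem_index_enum _).
rewrite psumr_eq0; last by move=> k _; rewrite exprn_ge0.
move=> /allP /(_ j (mem_index_enum _)) /implyP/(_ isT).
by rewrite expf_eq0 /= normr_eq0 => /eqP.
Qed.

Lemma mul_adj_eq0 m n (A : 'M[C]_(m, n)) : A *m adj A = 0 -> A = 0.
Proof.
by move=> A0; apply: mxtrace_adj_mul_eq0; rewrite mxtrace_mulC A0 mxtrace0.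
Qed.

(** Expands the nonnegative trace [\tr (adj (Y - Z) *m (Y - Z))]. Twice the real part appears as a
    sum with the conjugate, so the inequality stays in [C]. *)
Lemma mxtrace_adj_mul_amgm m n (Y Z : 'M[C]_(m, n)) :
  \tr (adj Y *m Z) + (\tr (adj Y *m Z))^* <=
  \tr (adj Y *m Y) + \tr (adj Z *m Z).
Proof.
rewrite -subr_ge0 -mxtrace_adj adj_mul adjK.
suff <- : \tr (adj (Y - Z) *m (Y - Z)) =
    \tr (adj Y *m Y) + \tr (adj Z *m Z) - (\tr (adj Y *m Z) + \tr (adj Z *m Y)).
  exact: mxtrace_adj_mul_ge0.
rewrite adjB mulmxBl mulmxBr [adj Z *m (Y - Z)]mulmxBr mxtraceB.
rewrite [X in X - _]mxtraceB [X in _ - X]mxtraceB.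
ring.
Qed.

End Adjoint.

(** * Spectral theorem and positive square roots *)

Section Psd.
Variable n : nat.
Implicit Types P A : 'M[C]_n.

Lemma inner_form_adj_mul m (S : 'M[C]_(m, n)) x :
  inner_form (adj S *m S) x = \tr (adj (S *m x) *m (S *m x)).
Proof. by rewrite /inner_form adj_mul trace_mx11 !mulmxA. Qed.

Lemma psd_adj_mul m (S : 'M[C]_(m, n)) : psd (adj S *m S).
Proof.
split; first by rewrite adj_mul adjK.
by move=> x; rewrite inner_form_adj_mul mxtrace_adj_mul_ge0.
Qed.

Lemma normal_spectral A : A *m adj A = adj A *m A ->
  exists (W : 'M[C]_n) (d : 'rV[C]_n),
    W \is unitarymx /\ A = adj W *m diag_mx d *m W.
Proof.
move=> nA; exists (spectralmx A), (spectral_diag A).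
split; first exact: spectral_unitarymx.
rewrite [adj (spectralmx A)]adjE -invmx_unitary ?spectral_unitarymx //.
by apply/orthomx_spectralP/normalmxP; rewrite -adjE.
Qed.

Lemma unitary_conjE (W D : 'M[C]_n) : W \is unitarymx ->
  W *m (adj W *m D *m W) *m adj W = D.
Proof.
move=> Wu.
by rewrite !mulmxA unitary_mul_adj // mul1mx -mulmxA unitary_mul_adj // mulmx1.
Qed.

Lemma inner_form_row A (W : 'M[C]_n) i :
  inner_form A (adj (row i W)) = (W *m A *m adj W) i i.
Proof.
by rewrite /inner_form adjK -!row_mul !mxE; apply: eq_bigr => j _; rewrite !mxE.
Qed.

Lemma psd_sqrt P : psd P -> exists2 S, psd S & S *m S = P.
Proof.
move=> [Ph Pp]; have [|W [d [Wu PE]]] := @normal_spectral P; first by rewrite Ph.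
(* An eigenvalue is the value of the form at its unit eigenvector, an adjoint row of [W]. *)
have d_ge0 i : 0 <= d 0 i.
  have := Pp (adj (row i W)).
  by rewrite inner_form_row PE unitary_conjE // mxE eqxx.
(* Fourth roots of the eigenvalues: the square root then has the shape [adj S *m S], which makes its
   positivity automatic. *)
have [e er ee] : exists2 e : 'rV[C]_n, adj (diag_mx e) = diag_mx e &
    diag_mx d = diag_mx e *m diag_mx e *m (diag_mx e *m diag_mx e).
  exists (map_mx (fun z => sqrtC (sqrtC z)) d).
    rewrite adj_diag; congr diag_mx; apply/rowP => i; rewrite !mxE.
    by rewrite geC0_conj // !sqrtC_ge0.
  rewrite !mulmx_diag; congr diag_mx; apply/rowP => i; rewrite !mxE.
  by rewrite -!expr2 !sqrtCK.
exists (adj (diag_mx e *m W) *m (diag_mx e *m W)); first exact: psd_adj_mul.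
rewrite PE ee adj_mul er; move: (diag_mx e) => D.
transitivity (adj W *m D *m D *m (W *m adj W) *m D *m D *m W).
  by rewrite !mulmxA.
by rewrite unitary_mul_adj // mulmx1 !mulmxA.
Qed.

End Psd.

(** * Polar decomposition *)

Section Polar.

(** Gram-Schmidt on a basis of the orthogonal complement of the row space; its dimension is [n - m]
    because [Q] has rank [m]. *)
Lemma unitary_complement m n (Q : 'M[C]_(m, n)) : Q \is unitarymx ->
  exists2 K : 'M[C]_(n - m, n), K \is unitarymx & Q *m adj K = 0.
Proof.
move=> Qu; rewrite -[m in (n - m)%N](mxrank_unitary Qu) -rank_ortho.
set O := orthomx _ _ _.
exists (schmidt (row_base O)); first by rewrite schmidt_unitarymx ?rank_leq_col.
rewrite adjE; apply/orthomx1P; rewrite orthomx_sym.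
by rewrite eqmx_schmidt_free ?row_base_free // eq_row_base.
Qed.

(** [Q] stacked on [K] has [n] orthonormal rows, so it is unitary; its adjoint times itself, read in
    blocks, is the sum. *)
Lemma unitary_complement_sum m n (Q : 'M[C]_(m, n)) (K : 'M[C]_(n - m, n)) :
  Q \is unitarymx -> K \is unitarymx -> Q *m adj K = 0 ->
  adj Q *m Q + adj K *m K = 1%:M.
Proof.
move=> Qu Ku QK.
have le_mn : (m <= n)%N by rewrite -(mxrank_unitary Qu) rank_leq_col.
have KQ : K *m adj Q = 0 by rewrite -[K]adjK -adj_mul QK /adj map_mx0 trmx0.
have Su : col_mx Q K \is unitarymx.
  apply: mul_adj_unitary.
  rewrite /adj map_col_mx tr_col_mx mul_col_row -/(adj Q) -/(adj K).
  by rewrite !unitary_mul_adj // QK KQ -scalar_mx_block.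
have := mulmxKtV (1%:M : 'M[C]_n) Su (subnKC le_mn).
by rewrite -adjE mul1mx /adj map_col_mx tr_col_mx mul_row_col.
Qed.

(* A partial isometry carrying the row space of B onto that of A exists because
   the two Gram matrices agree; it extends to a unitary since the orthogonal
   complements of the two row spaces have the same dimension. *)
Lemma gram_unitary n (A B : 'M[C]_n) : A *m adj A = B *m adj B ->
  exists2 V : 'M[C]_n, V \is unitarymx & A = B *m V.
Proof.
move=> AB.
pose Q := schmidt (row_base A).
have Qu : Q \is unitarymx by rewrite schmidt_unitarymx ?rank_leq_col.
have QA : (Q :=: A)%MS.
  apply: eqmx_trans (eq_row_base A).
  by apply: eqmx_schmidt_free; rewrite row_base_free.
have /submxP[T QE] : (Q <= A)%MS by rewrite QA.
have /submxP[L AE] : (A <= Q)%MS by rewrite QA.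
pose Q' := T *m B.
have Q'u : Q' \is unitarymx.
  apply: mul_adj_unitary; rewrite adj_mul mulmxA -(mulmxA T) -AB.
  by rewrite -!mulmxA -adj_mul mulmxA -QE unitary_mul_adj.
(* The residual [B - L *m (T *m B)] has the same Gram matrix as [A - L *m (T *m A)], which
   vanishes. *)
have BE : B = L *m Q'.
  apply/eqP; rewrite -subr_eq0; apply/eqP; apply: mul_adj_eq0.
  have gramE (X : 'M[C]_n) :
      (X - L *m (T *m X)) *m adj (X - L *m (T *m X)) =
      (1%:M - L *m T) *m (X *m adj X) *m adj (1%:M - L *m T).
    by rewrite -!mulmxA -adj_mul mulmxA !mulmxBl !mul1mx !mulmxA.
  by rewrite /Q' gramE -AB -gramE -QE -AE subrr mul0mx.
have [K Ku QK] := unitary_complement Qu.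
have [K' K'u QK'] := unitary_complement Q'u.
have KQ : K *m adj Q = 0 by rewrite -[K]adjK -adj_mul QK /adj map_mx0 trmx0.
clearbody Q'.
exists (adj Q' *m Q + adj K' *m K).
  apply: mul_adj_unitary; rewrite adjD !adj_mul !adjK mulmxDl !mulmxDr !mulmxA.
  rewrite -(mulmxA _ Q (adj Q)) -(mulmxA _ Q (adj K)).
  rewrite -(mulmxA _ K (adj Q)) -(mulmxA _ K (adj K)).
  rewrite !unitary_mul_adj // QK KQ !mulmx0 !mul0mx !mulmx1 addr0 add0r.
  exact: unitary_complement_sum.
rewrite BE -mulmxA mulmxDr !mulmxA unitary_mul_adj // QK' mul0mx addr0 mul1mx.
exact: AE.
Qed.

(** A square root exists by [psd_sqrt], so [xget] does not fall back on its default [0]. *)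
Lemma absmxP n (A : 'M[C]_n) : psd (absmx A) /\ absmx A *m absmx A = adj A *m A.
Proof.
have [S Sp SE] := psd_sqrt (psd_adj_mul A).
rewrite /absmx; case: xgetP => [P _ //|/(_ S)]; last by case.
Qed.

(** [adj A] and [absmx A] have equal Gram matrices, so [gram_unitary] relates them; taking adjoints
    moves the unitary to the left. *)
Lemma polar n (A : 'M[C]_n) : exists2 V, V \is unitarymx & A = V *m absmx A.
Proof.
have [[Ph _] PE] := absmxP A.
have [|V Vu AE] := @gram_unitary n (adj A) (absmx A); first by rewrite adjK Ph.
exists (adj V); first by rewrite adj_unitary.
by rewrite -[LHS]adjK AE adj_mul Ph.
Qed.

Lemma absmx_gram n (A : 'M[C]_n) : exists Q : 'M[C]_n, absmx A = Q *m adj Q.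
Proof.
have [Pp _] := absmxP A; have [S [Sh _] SE] := psd_sqrt Pp.
by exists S; rewrite Sh SE.
Qed.

End Polar.

(** * The trace norm as a maximum over unitaries *)

Section Duality.
Variable n : nat.
Implicit Types A B U : 'M[C]_n.

Lemma mxtrace_absmx_ge0 A : 0 <= \tr (absmx A).
Proof. by have [Q ->] := absmx_gram A; rewrite mxtrace_mulC mxtrace_adj_mul_ge0. Qed.

Lemma trnormE A : (trnorm A)%:C%C = \tr (absmx A).
Proof. by rewrite /trnorm RRe_real // ger0_real // mxtrace_absmx_ge0. Qed.

Lemma trnorm_ge0 A : 0 <= trnorm A.
Proof. by rewrite -ler0c trnormE mxtrace_absmx_ge0. Qed.

Lemma real_normc (z : C) : (Normc.normc z)%:C%C = `|z|.
Proof. by case: z. Qed.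

Lemma trnorm_attained A :
  exists2 U, U \is unitarymx & \tr (U *m A) = (trnorm A)%:C%C.
Proof.
have [V Vu AE] := polar A; exists (adj V); first by rewrite adj_unitary.
by rewrite {1}AE mulmxA unitary_adj_mul // mul1mx trnormE.
Qed.

Lemma gram_mul_unitary m U (X : 'M[C]_(n, m)) :
  U \is unitarymx -> adj (U *m X) *m (U *m X) = adj X *m X.
Proof.
move=> Uu; transitivity (adj X *m (adj U *m U) *m X).
  by rewrite adj_mul !mulmxA.
by rewrite unitary_adj_mul // mulmx1.
Qed.

Lemma mxtrace_isometric_sum k (Cs : 'I_k -> 'M[C]_n) (X : 'M[C]_n) :
  \sum_(i < k) adj (Cs i) *m Cs i = 1%:M ->
  \sum_(i < k) \tr (adj (Cs i *m X) *m (Cs i *m X)) = \tr (adj X *m X).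
Proof.
move=> C1; rewrite -raddf_sum /= -[in RHS](mulmx1 (adj X)) -C1.
rewrite mulmx_sumr mulmx_suml; congr (\tr _); apply: eq_bigr => i _.
by rewrite adj_mul !mulmxA.
Qed.

(** With [A = V *m Q *m adj Q], each trace pairs [Y i] with [Z i], and both families have total
    squared Frobenius norm [\tr (adj Q *m Q)], the trace norm of [A]. Keeping [t] as a variable lets
    it be instantiated by a real number, where the left side is [2 t]. *)
Lemma mxtrace_compression_le k (Cs Us : 'I_k -> 'M[C]_n) A :
  \sum_(i < k) adj (Cs i) *m Cs i = 1%:M ->
  (forall i, Us i \is unitarymx) ->
  forall t, t = \sum_(i < k) \tr (Us i *m (Cs i *m A *m adj (Cs i))) ->
  t + t^* <= (trnorm A)%:C%C *+ 2.
Proof.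
move=> C1 Uu t tE; have [V Vu AE] := polar A; have [Q PE] := absmx_gram A.
pose Y i := Cs i *m Q; pose Z i := Us i *m (Cs i *m (V *m Q)).
have -> : t = \sum_i \tr (adj (Y i) *m Z i).
  rewrite tE; apply: eq_bigr => i _; rewrite [RHS]mxtrace_mulC {1}AE PE /Y /Z.
  by rewrite adj_mul !mulmxA.
rewrite rmorph_sum -big_split /=.
apply: le_trans (ler_sum _ (fun i _ => mxtrace_adj_mul_amgm (Y i) (Z i))) _.
rewrite big_split /= mxtrace_isometric_sum //.
have -> : \sum_i \tr (adj (Z i) *m Z i) = \tr (adj (V *m Q) *m (V *m Q)).
  rewrite -(mxtrace_isometric_sum _ C1); apply: eq_bigr => i _.
  exact: (congr1 mxtrace (gram_mul_unitary _ (Uu i))).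
rewrite gram_mul_unitary //.
by rewrite trnormE PE mxtrace_mulC mulr2n.
Qed.

(** The case of one compression by the identity: the phase [|z| / z] is absorbed into [U], turning
    the trace into its modulus. *)
Lemma norm_mxtrace_unitary_le U A :
  U \is unitarymx -> `|\tr (U *m A)| <= (trnorm A)%:C%C.
Proof.
move=> Uu; have [->|z0] := eqVneq (\tr (U *m A)) 0.
  by rewrite normr0 ler0c trnorm_ge0.
set z := \tr (U *m A) in z0 *.
have c1 : `| `|z| / z | = 1 by rewrite normf_div normr_id divff // normr_eq0.
have C1 : \sum_(i < 1) adj (1%:M : 'M[C]_n) *m 1%:M = 1%:M.
  by rewrite big_ord1 adj_id mulmx1.
have zE : `|z| = \sum_(i < 1)
    \tr ((`|z| / z) *: U *m (1%:M *m A *m adj (1%:M : 'M[C]_n))).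
  by rewrite big_ord1 adj_id mul1mx mulmx1 -scalemxAl mxtraceZ -/z divfK.
have := mxtrace_compression_le C1 (fun=> unitaryZ c1 Uu) zE.
by rewrite geC0_conj ?normr_ge0 // -mulr2n ler_pMn2r.
Qed.

(** With the preceding bound, the trace norm is a maximum of moduli of linear functionals;
    homogeneity and the triangle inequality follow. *)
Lemma trnorm_attained_norm A :
  exists2 U, U \is unitarymx & `|\tr (U *m A)| = (trnorm A)%:C%C.
Proof.
have [U Uu UE] := trnorm_attained A; exists U => //.
by rewrite UE ger0_norm // ler0c trnorm_ge0.
Qed.

Lemma trnormZ (c : C) A : trnorm (c *: A) = Normc.normc c * trnorm A.
Proof.
have trZ U : `|\tr (U *m (c *: A))| = `|c| * `|\tr (U *m A)|.
  by rewrite -scalemxAr mxtraceZ normrM.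
apply/eqP; rewrite eq_le -!lecR rmorphM /= real_normc; apply/andP; split.
  have [U Uu <-] := trnorm_attained_norm (c *: A).
  by rewrite trZ ler_wpM2l // norm_mxtrace_unitary_le.
have [U Uu <-] := trnorm_attained_norm A.
by rewrite -trZ norm_mxtrace_unitary_le.
Qed.

Lemma trnormD A B : trnorm (A + B) <= trnorm A + trnorm B.
Proof.
rewrite -lecR rmorphD /=; have [U Uu <-] := trnorm_attained_norm (A + B).
rewrite mulmxDr mxtraceD; apply: le_trans (ler_normD _ _) _.
by apply: lerD; apply: norm_mxtrace_unitary_le.
Qed.

Lemma trnorm_eq0 A : trnorm A = 0 -> A = 0.
Proof.
move=> A0; have [V _ ->] := polar A; have [Q PE] := absmx_gram A.
have : \tr (adj (adj Q) *m adj Q) = 0 by rewrite adjK -PE -trnormE A0.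
by move/mxtrace_adj_mul_eq0 => Q0; rewrite PE Q0 !mulmx0.
Qed.

Lemma trnorm_Lnorm : is_Lnorm (@trnorm R n).
Proof.
split.
  split; [exact: trnorm_ge0 | exact: trnorm_eq0 | exact: trnormZ | exact: trnormD].
move=> k Cs X C1.
(* Each summand gets its own maximising unitary, so the sum of norms becomes a sum of traces. *)
have /boolp.choice[U UP] : forall i, exists V : 'M[C]_n, V \is unitarymx /\
    \tr (V *m (Cs i *m X *m adj (Cs i))) =
    (trnorm (Cs i *m X *m adj (Cs i)))%:C%C.
  by move=> i; have [V] := trnorm_attained (Cs i *m X *m adj (Cs i)); exists V.
set s := \sum_(_ < _) _.
have sE : s%:C%C = \sum_(i < k) \tr (U i *m (Cs i *m X *m adj (Cs i))).
  by rewrite rmorph_sum; apply: eq_bigr => i _; rewrite (UP i).2.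
have := mxtrace_compression_le C1 (fun i => (UP i).1) sE.
rewrite geC0_conj; last first.
  by rewrite ler0c sumr_ge0 // => i _; apply: trnorm_ge0.
by rewrite -mulr2n ler_pMn2r // lecR.
Qed.

(** * Rank-one projections and the numerical radius *)

Section UnitVector.
Variables (x : 'cV[C]_n) (x1 : inner_form 1%:M x = 1).

Lemma unit_adj_mul : adj x *m x = 1%:M.
Proof.
have := x1; rewrite /inner_form mulmx1 => x1'.
by apply/matrixP => i j; rewrite !ord1 x1' mxE eqxx.
Qed.

Lemma proj_unit_adj : adj (x *m adj x) = x *m adj x.
Proof. by rewrite adj_mul adjK. Qed.

Lemma proj_unit_idem : x *m adj x *m (x *m adj x) = x *m adj x.
Proof. by rewrite mulmxA -(mulmxA x) unit_adj_mul mulmx1. Qed.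

Lemma proj_unit_compression A :
  x *m adj x *m A *m (x *m adj x) = inner_form A x *: (x *m adj x).
Proof.
transitivity (x *m (adj x *m A *m x) *m adj x); first by rewrite !mulmxA.
by rewrite [adj x *m A *m x]mx11_scalar mul_mx_scalar -scalemxAl.
Qed.

Lemma inner_form_mxtrace A : inner_form A x = \tr (x *m adj x *m A).
Proof. by rewrite /inner_form -trace_mx11 -[in RHS]mulmxA [RHS]mxtrace_mulC. Qed.

Lemma inner_form_proj (c : C) : inner_form (c *: (x *m adj x)) x = c.
Proof.
rewrite inner_form_mxtrace -scalemxAr proj_unit_idem mxtraceZ mxtrace_mulC.
by rewrite unit_adj_mul mxtrace1 mulr1.
Qed.

(* The projection x x^* is the average of the unitaries 1 and 2 x x^* - 1. *)
Lemma normc_inner_form_le_trnorm A : Normc.normc (inner_form A x) <= trnorm A.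
Proof.
rewrite inner_form_mxtrace; set E := x *m adj x.
have FF : (E + E) *m (E + E) = (E + E) + (E + E).
  by rewrite mulmxDl mulmxDr proj_unit_idem.
have Vu : 1%:M - (E + E) \is unitarymx.
  apply: mul_adj_unitary; rewrite adjB adj_id adjD proj_unit_adj.
  by rewrite mulmxBr mulmx1 mulmxBl mul1mx FF opprB addrK subrK.
have E2 : \tr (E *m A) *+ 2 = \tr (1%:M *m A) - \tr ((1%:M - (E + E)) *m A).
  by rewrite mulmxBl mxtraceB opprB addrC subrK mulmxDl mxtraceD mulr2n.
rewrite -lecR real_normc -(ler_pMn2r (ltn0Sn 1)) -normrMn E2 mulr2n.
have Iu : (1%:M : 'M[C]_n) \is unitarymx.
  by apply: mul_adj_unitary; rewrite adj_id mulmx1.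
apply: le_trans (ler_normB _ _) (lerD _ _).
  exact: norm_mxtrace_unitary_le Iu.
exact: norm_mxtrace_unitary_le Vu.
Qed.

End UnitVector.

(** The set under [sup] must be bounded for this; the trace norm bounds it. *)
Lemma normc_inner_form_le_numrad A (x : 'cV[C]_n) :
  inner_form 1%:M x = 1 -> Normc.normc (inner_form A x) <= numrad A.
Proof.
move=> x1; apply: ub_le_sup; last by exists x.
by exists (trnorm A) => _ [y [y1 ->]]; apply: normc_inner_form_le_trnorm.
Qed.

Lemma numrad_le_trnorm A : numrad A <= trnorm A.
Proof.
rewrite /numrad; set E := [set _ | _]%classic.
(* For [n = 0] there is no unit vector, and the supremum of the empty set is [0]. *)
have [->|/set0P E0] := eqVneq E set0; first by rewrite sup0 trnorm_ge0.
by apply: ge_sup => // _ [y [y1 ->]]; apply: normc_inner_form_le_trnorm.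
Qed.

(** * Minimality of the trace norm *)

Lemma trnorm_min (N : 'M[C]_n -> R) : is_Lnorm N ->
  (forall A, numrad A <= N A) -> forall A, trnorm A <= N A.
Proof.
move=> [_ NL] Nw A; have [V Vu AE] := polar A.
have trVA : \tr (adj V *m A) = (trnorm A)%:C%C.
  by rewrite {1}AE mulmxA unitary_adj_mul // mul1mx trnormE.
have [|W [d [Wu VE]]] := normal_spectral (A := adj V).
  by rewrite adjK unitary_adj_mul // unitary_mul_adj.
(* [diag_mx d] equals [W *m adj V *m adj W], a product of unitaries. *)
have d1 i : `|d 0 i| = 1.
  have : diag_mx d *m adj (diag_mx d) = 1%:M.
    apply: unitary_mul_adj.
    rewrite -(unitary_conjE (diag_mx d) Wu) -VE.
    have V'u : adj V \is unitarymx by rewrite (adj_unitary V).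
    have W'u : adj W \is unitarymx by rewrite (adj_unitary W).
    exact: mul_unitarymx (mul_unitarymx Wu V'u) W'u.
  rewrite adj_diag mulmx_diag => /matrixP/(_ i i); rewrite !mxE eqxx !mulr1n.
  by rewrite -normCK => /eqP; rewrite pexpr_eq1 // => /eqP.
pose x i := adj (row i W).
have x1 i : inner_form 1%:M (x i) = 1.
  by rewrite inner_form_row mulmx1 unitary_mul_adj // mxE eqxx.
pose Cs i := x i *m adj (x i).
(* Each [Cs i] is a projection, so the sum is that of all [x i *m adj (x i)], namely
   [adj W *m W]. *)
have C1 : \sum_i adj (Cs i) *m Cs i = 1%:M.
  rewrite -(unitary_adj_mul Wu); apply/matrixP => k l.
  rewrite summxE mxE; apply: eq_bigr => i _.
  rewrite proj_unit_adj proj_unit_idem // /x adjK !mxE big_ord1.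
  by rewrite !mxE.
apply: le_trans (NL _ _ A C1).
have trE : (trnorm A)%:C%C = \sum_i d 0 i * inner_form A (x i).
  rewrite -trVA VE -!mulmxA mxtrace_mulC -!mulmxA.
  apply: eq_bigr => i _; rewrite inner_form_row mul_diag_mx mxE.
  by rewrite !mulmxA.
rewrite -lecR -[X in X <= _]ger0_norm ?ler0c ?trnorm_ge0 // trE.
apply: le_trans (ler_norm_sum _ _ _) _.
rewrite rmorph_sum; apply: ler_sum => i _ /=.
rewrite normrM d1 mul1r -real_normc lecR; apply: le_trans (Nw _).
rewrite proj_unit_adj proj_unit_compression.
(* The scalar is the value at [x i] of the form of the compressed matrix, hence is bounded by its
   numerical radius. *)
rewrite -{1}(inner_form_proj (x1 i) (inner_form A (x i))).
exact: normc_inner_form_le_numrad.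
Qed.

End Duality.
End TraceNorm.

(* The trace norm is the minimum of the class of L-norms N on M_n with
   numrad A <= N A for all A. *)
Theorem theorem3p4 (R : realType) (n : nat) :
  (is_Lnorm (@trnorm R n) /\ forall A : 'M[R[i]]_n, numrad A <= trnorm A) /\
  (forall N : 'M[R[i]]_n -> R,
     is_Lnorm N -> (forall A, numrad A <= N A) ->
     forall A, trnorm A <= N A).
Proof.
split; last by move=> N NL Nw A; apply: trnorm_min.
by split; [apply: trnorm_Lnorm | apply: numrad_le_trnorm].
Qed.
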